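(* The category $rSGPD_{\vee}$ of restriction semigroupoids and $\vee$-premorphisms and the category $liCAT_{of}$ of locally inductive categories and ordered functors are isomorphic.
   Context: **Semigroupoid.** A semigroupoid is a triple $(S,S^{(2)},\star)$ with $S$ a set, $S^{(2)}\subseteq S\times S$ and $\star\colon S^{(2)}\to S$ such that for all $s,t,r\in S$: if either ($(s,t),(t,r)\in S^{(2)}$), or ($(s,t),(s\star t,r)\in S^{(2)}$), or ($(t,r),(s,t\star r)\in S^{(2)}$), then all of $(s,t),(t,r),(s\star t,r),(s,t\star r)$ lie in $S^{(2)}$ and $(s\star t)\star r=s\star(t\star r)$. Write $st=s\star t$; ''$st$ is defined'' means $(s,t)\in S^{(2)}$. **Restriction semigroupoid (two-sided).** A triple $(S,+,\ast)$ with $S$ a semigroupoid and unary operations $s\mapsto s^+$, $s\mapsto s^\ast$ on $S$ such that for all $s,t\in S$: (i) $s^+s$ and $ss^\ast$ are defined, $s^+s=s$ and $ss^\ast=s$; (ii) if $s^+t^+$ is defined, then $t^+s^+$ is defined and $s^+t^+=t^+s^+$; if $s^\ast t^\ast$ is defined, then $t^\ast s^\ast$ is defined and $s^\ast t^\ast=t^\ast s^\ast$; (iii) if $s^+t^+$ is defined, then $s^+t^+=(s^+t)^+$; if $s^\ast t^\ast$ is defined, then $s^\ast t^\ast=(st^\ast)^\ast$; (iv) if $st$ is defined, then $st^+=(st)^+s$ and $s^\ast t=t(st)^\ast$; (v) $s^+=(s^+)^\ast$ and $s^\ast=(s^\ast)^+$. It is partially ordered by: $s\leq t$ iff $s^+t$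 is defined and $s^+t=s$ (equivalently, $ts^\ast$ is defined and $ts^\ast=s$). **$\vee$-premorphism.** A function $\varphi\colon S\to T$ between restriction semigroupoids such that: if $st$ is defined, then $\varphi(s)\varphi(t)$ is defined and $\varphi(st)\leq\varphi(s)\varphi(t)$; and $\varphi(s^+)=\varphi(s)^+$, $\varphi(s^\ast)=\varphi(s)^\ast$ for every $s\in S$. Restriction semigroupoids with $\vee$-premorphisms and composition of functions form the category $rSGPD_{\vee}$. **Category.** A (small) category consists of sets $\mathcal{C}_0\subseteq\mathcal{C}$, maps $D,R\colon\mathcal{C}\to\mathcal{C}_0$ and a partial operation $\circ$ on $\mathcal{C}$, with $x\circ y$ defined iff $D(x)=R(y)$, such that: $D(x\circ y)=D(y)$ and $R(x\circ y)=R(x)$; $\circ$ is associative on composable triples; for $e\in\mathcal{C}_0$, $D(e)=e=R(e)$, and $x\circ e=x$, $e\circ y=y$ whenever $D(x)=e=R(y)$. **Local meet-semilattice.** A semigroupoid $X$ such that for every $e\in X$, $ee$ is defined and $ee=e$, and whenever $ef$ is defined, $fe$ is defined and $ef=fe$. Its partial order is: $e\leq f$ iff $ef$ is defined and $ef=e$. The operation is denoted $\wedge$ and is determined by $\leq$; a poset $(X,\le)$ is called a local meet-semilattice if $\le$ arises this way. **Locally inductive category.** A pair $(\mathcal{C},\leq)$ with $\mathcal{C}$ a category and $\leq$ a partial order on $\mathcal{C}$ such that: $x\leq y$ implies $D(x)\leq D(y)$ and $R(x)\leq R(y)$; if $x\leq y$, $x'\leq y'$ and $x\circ x'$, $y\circ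 y'$ are defined, then $x\circ x'\leq y\circ y'$; for each $x\in\mathcal{C}$ and $e\in\mathcal{C}_0$ with $e\leq D(x)$ there is a unique $x|e\in\mathcal{C}$ (restriction) with $x|e\leq x$ and $D(x|e)=e$; for each $x\in\mathcal{C}$ and $e\in\mathcal{C}_0$ with $e\leq R(x)$ there is a unique $e|x\in\mathcal{C}$ (corestriction) with $e|x\leq x$ and $R(e|x)=e$; and $\mathcal{C}_0$ is a local meet-semilattice with partial order (the restriction of) $\leq$. **Ordered functor.** A function $\varphi\colon\mathcal{C}\to\mathcal{D}$ between locally inductive categories such that: $\varphi(D(x))=D(\varphi(x))$ and $\varphi(R(x))=R(\varphi(x))$ for every $x\in\mathcal{C}$; if $D(x)=R(y)$, then $\varphi(x)\circ\varphi(y)=\varphi(x\circ y)$; if $x\leq y$, then $\varphi(x)\leq\varphi(y)$. Locally inductive categories with ordered functors and composition of functions form the category $liCAT_{of}$. *)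

(* Defs.v *)
From mathcomp Require Import all_boot boolp.
From Stdlib Require Relation_Definitions.

Set Implicit Arguments.
Unset Strict Implicit.
Unset Printing Implicit Defensive.

(* A partial binary operation on S with domain S2 ⊆ S × S is encoded as
   mul : S -> S -> option S, with (s, t) \in S2 iff mul s t is some value.
   Carriers are arbitrary, possibly empty, types. *)

Definition defined (X : Type) (o : option X) : Prop := exists x, o = Some x.

Definition is_semigroupoid (S : Type) (mul : S -> S -> option S) : Prop :=
  forall s t r : S,
    (defined (mul s t) /\ defined (mul t r)) \/
    (exists st, mul s t = Some st /\ defined (mul st r)) \/
    (exists tr, mul t r = Some tr /\ defined (mul s tr)) ->
    exists st tr u, [/\ mul s t = Some st, mul t r = Some tr,
                        mul st r = Some u & mul s tr = Some u].

Record is_restriction_semigroupoid (S : Type) (mul : S -> S -> option S)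
    (plus star : S -> S) : Prop := IsRestrictionSemigroupoid {
  rs_semigroupoid : is_semigroupoid mul;
  rs_plusL : forall s, mul (plus s) s = Some s;
  rs_starR : forall s, mul s (star s) = Some s;
  rs_plusC : forall s t u,
    mul (plus s) (plus t) = Some u -> mul (plus t) (plus s) = Some u;
  rs_starC : forall s t u,
    mul (star s) (star t) = Some u -> mul (star t) (star s) = Some u;
  rs_plusM : forall s t u, mul (plus s) (plus t) = Some u ->
    exists2 v, mul (plus s) t = Some v & u = plus v;
  rs_starM : forall s t u, mul (star s) (star t) = Some u ->
    exists2 v, mul s (star t) = Some v & u = star v;
  rs_ampleL : forall s t st, mul s t = Some st ->
    exists2 u, mul s (plus t) = Some u & mul (plus st) s = Some u;
  rs_ampleR : forall s t st, mul s t = Some st ->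
    exists2 u, mul (star s) t = Some u & mul t (star st) = Some u;
  rs_plusK : forall s, plus s = star (plus s);
  rs_starK : forall s, star s = plus (star s)
}.

Record rsgpd : Type := RSgpd {
  rs_carrier :> Type;
  rs_mul : rs_carrier -> rs_carrier -> option rs_carrier;
  rs_plus : rs_carrier -> rs_carrier;
  rs_star : rs_carrier -> rs_carrier;
  rs_axioms : is_restriction_semigroupoid rs_mul rs_plus rs_star
}.

Definition rs_le (S : rsgpd) (s t : S) : Prop :=
  rs_mul (rs_plus s) t = Some s.

Record is_vpremorphism (S T : rsgpd) (phi : S -> T) : Prop :=
  IsVPremorphism {
  vpm_mul : forall s t st, rs_mul s t = Some st ->
    exists2 u, rs_mul (phi s) (phi t) = Some u & rs_le (phi st) u;
  vpm_plus : forall s, phi (rs_plus s) = rs_plus (phi s);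
  vpm_star : forall s, phi (rs_star s) = rs_star (phi s)
}.

Record vpremorphism (S T : rsgpd) : Type := VPremorphism {
  vpm_fun :> S -> T;
  vpm_axioms : is_vpremorphism vpm_fun
}.

(* C0 is the subset of objects, and D, R take their values in C0. *)
Record is_category (C : Type) (C0 : C -> Prop) (D R : C -> C)
    (comp : C -> C -> option C) : Prop := IsCategory {
  cat_D0 : forall x, C0 (D x);
  cat_R0 : forall x, C0 (R x);
  cat_comp_def : forall x y, defined (comp x y) <-> D x = R y;
  cat_Dcomp : forall x y xy, comp x y = Some xy -> D xy = D y;
  cat_Rcomp : forall x y xy, comp x y = Some xy -> R xy = R x;
  cat_compA : forall x y z xy yz,
    comp x y = Some xy -> comp y z = Some yz -> comp xy z = comp x yz;
  cat_Did : forall e, C0 e -> D e = e;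
  cat_Rid : forall e, C0 e -> R e = e;
  cat_compR : forall x e, C0 e -> D x = e -> comp x e = Some x;
  cat_compL : forall e y, C0 e -> e = R y -> comp e y = Some y
}.

Record is_local_meet_semilattice (X : Type) (meet : X -> X -> option X)
    : Prop := IsLocalMeetSemilattice {
  lms_semigroupoid : is_semigroupoid meet;
  lms_idem : forall e, meet e e = Some e;
  lms_comm : forall e f u, meet e f = Some u -> meet f e = Some u
}.

Definition is_local_meet_semilattice_order (X : Type) (le : X -> X -> Prop)
    : Prop :=
  exists2 meet : X -> X -> option X, is_local_meet_semilattice meet &
    forall e f, le e f <-> meet e f = Some e.

Record is_locally_inductive (C : Type) (C0 : C -> Prop) (D R : C -> C)
    (comp : C -> C -> option C) (le : C -> C -> Prop) : Prop :=
  IsLocallyInductive {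
  li_category : is_category C0 D R comp;
  li_order : Relation_Definitions.order C le;
  li_leD : forall x y, le x y -> le (D x) (D y);
  li_leR : forall x y, le x y -> le (R x) (R y);
  li_le_comp : forall x y x' y' xx' yy', le x y -> le x' y' ->
    comp x x' = Some xx' -> comp y y' = Some yy' -> le xx' yy';
  li_restriction : forall x e, C0 e -> le e (D x) ->
    exists! z, le z x /\ D z = e;
  li_corestriction : forall x e, C0 e -> le e (R x) ->
    exists! z, le z x /\ R z = e;
  li_objects : is_local_meet_semilattice_order
    (fun e f : {x : C | C0 x} => le (sval e) (sval f))
}.

Record licat : Type := LICat {
  li_carrier :> Type;
  li_C0 : li_carrier -> Prop;
  li_D : li_carrier -> li_carrier;
  li_R : li_carrier -> li_carrier;
  li_comp : li_carrier -> li_carrier -> option li_carrier;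
  li_le : li_carrier -> li_carrier -> Prop;
  li_axioms : is_locally_inductive li_C0 li_D li_R li_comp li_le
}.

Record is_ordered_functor (C D : licat) (phi : C -> D) : Prop :=
  IsOrderedFunctor {
  of_D : forall x, phi (li_D x) = li_D (phi x);
  of_R : forall x, phi (li_R x) = li_R (phi x);
  of_comp : forall x y xy, li_comp x y = Some xy ->
    li_comp (phi x) (phi y) = Some (phi xy);
  of_le : forall x y, li_le x y -> li_le (phi x) (phi y)
}.

Record ordered_functor (C D : licat) : Type := OrderedFunctor {
  of_fun :> C -> D;
  of_axioms : is_ordered_functor of_fun
}.

(* Distinct from the single-sorted is_category above: these are the possibly
   large categories in which rsgpd and licat are the types of objects. *)
Record Category : Type := MkCategory {
  Ob :> Type;
  Hom : Ob -> Ob -> Type;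
  idm : forall A, Hom A A;
  compm : forall A B C, Hom B C -> Hom A B -> Hom A C;
  compm1 : forall A B (f : Hom A B), compm f (idm A) = f;
  comp1m : forall A B (f : Hom A B), compm (idm B) f = f;
  compmA : forall A B C D (h : Hom C D) (g : Hom B C) (f : Hom A B),
    compm h (compm g f) = compm (compm h g) f
}.

Record Functor (A B : Category) : Type := MkFunctor {
  Fob :> A -> B;
  Fhom : forall x y : A, Hom x y -> Hom (Fob x) (Fob y);
  Fhom_id : forall x : A, Fhom (idm x) = idm (Fob x);
  Fhom_comp : forall (x y z : A) (g : Hom y z) (f : Hom x y),
    Fhom (compm g f) = compm (Fhom g) (Fhom f)
}.

Definition functor_id (A : Category) : Functor A A :=
  @MkFunctor A A (fun x => x) (fun x y f => f)
    (fun x => erefl) (fun x y z g f => erefl).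

Section FunctorComp.
Variables (A B C : Category) (G : Functor B C) (F : Functor A B).

Lemma functor_comp_id (x : A) : Fhom G (Fhom F (idm x)) = idm (G (F x)).
Proof. by rewrite !Fhom_id. Qed.

Lemma functor_comp_comp (x y z : A) (g : Hom y z) (f : Hom x y) :
  Fhom G (Fhom F (compm g f)) =
  compm (Fhom G (Fhom F g)) (Fhom G (Fhom F f)).
Proof. by rewrite !Fhom_comp. Qed.

Definition functor_comp : Functor A C :=
  @MkFunctor A C (fun x => G (F x)) (fun x y f => Fhom G (Fhom F f))
    functor_comp_id functor_comp_comp.
End FunctorComp.

Definition isomorphic_categories (A B : Category) : Prop :=
  exists (F : Functor A B) (G : Functor B A),
    functor_comp G F = functor_id A /\ functor_comp F G = functor_id B.

Section RSgpdTheory.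
Variable S : rsgpd.
Implicit Types s t r u : S.

Lemma rs_le_refl s : rs_le s s.
Proof. exact: rs_plusL (rs_axioms S) s. Qed.

Lemma rs_le_trans t s r : rs_le s t -> rs_le t r -> rs_le s r.
Proof.
have [sg _ _ _ _ plusM _ _ _ _ _] := rs_axioms S.
rewrite /rs_le => st tr.
have [|p [q [w [e1 e2 e3 e4]]]] := sg (rs_plus s) (rs_plus t) r.
  by right; right; exists t; split=> //; exists s.
have [v] := plusM _ _ _ e1; rewrite st => -[<-] def_p.
by move: e2 e3 e4; rewrite tr def_p => -[<-] ->; rewrite st => ->.
Qed.

Lemma rs_le_plusL s t u : rs_mul (rs_plus s) t = Some u -> rs_le u t.
Proof.
have [sg plusL _ _ _ plusM _ _ _ _ _] := rs_axioms S.
rewrite /rs_le => stu.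
have [|p [q [w [e1 e2 e3 e4]]]] := sg (rs_plus s) (rs_plus t) t.
  by right; right; exists t; split; [exact: plusL | exists u].
have [v] := plusM _ _ _ e1; rewrite stu => -[<-] def_p.
by move: e2 e3 e4; rewrite plusL def_p => -[<-] ->; rewrite stu => ->.
Qed.
End RSgpdTheory.

Lemma vpm_le (S T : rsgpd) (phi : vpremorphism S T) (s t : S) :
  rs_le s t -> rs_le (phi s) (phi t).
Proof.
have [phiM phi_plus _] := vpm_axioms phi.
move=> /phiM [u]; rewrite phi_plus => /rs_le_plusL le_ut le_su.
exact: rs_le_trans le_su le_ut.
Qed.

Lemma vpm_id_axioms (S : rsgpd) : is_vpremorphism (fun s : S => s).
Proof. by split=> // s t st e; exists st => //; exact: rs_le_refl. Qed.

Lemma vpm_comp_axioms (S T U : rsgpd) (psi : vpremorphism T U)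
  (phi : vpremorphism S T) : is_vpremorphism (fun s => psi (phi s)).
Proof.
have [phiM phi_plus phi_star] := vpm_axioms phi.
have [psiM psi_plus psi_star] := vpm_axioms psi.
split=> [s t st /phiM[u /psiM[v e le_uv] le_u]|s|s].
- exists v => //; apply: rs_le_trans le_uv; exact: vpm_le.
- by rewrite phi_plus psi_plus.
- by rewrite phi_star psi_star.
Qed.

Definition vpm_id (S : rsgpd) : vpremorphism S S :=
  VPremorphism (vpm_id_axioms S).

Definition vpm_comp (S T U : rsgpd) (psi : vpremorphism T U)
  (phi : vpremorphism S T) : vpremorphism S U :=
  VPremorphism (vpm_comp_axioms psi phi).

Lemma vpm_eq (S T : rsgpd) (phi psi : vpremorphism S T) :
  vpm_fun phi = vpm_fun psi -> phi = psi.
Proof.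
case: phi psi => [f Hf] [g Hg] /= efg; case: g / efg Hg => Hg.
by rewrite (Prop_irrelevance Hf Hg).
Qed.

Definition rSGPD_v : Category :=
  @MkCategory rsgpd vpremorphism vpm_id vpm_comp
    (fun S T f => @vpm_eq S T (vpm_comp f (vpm_id S)) f erefl)
    (fun S T f => @vpm_eq S T (vpm_comp (vpm_id T) f) f erefl)
    (fun S T U V h g f => @vpm_eq S V (vpm_comp h (vpm_comp g f))
                            (vpm_comp (vpm_comp h g) f) erefl).

Lemma of_id_axioms (C : licat) : is_ordered_functor (fun x : C => x).
Proof. by split. Qed.

Lemma of_comp_axioms (C D E : licat) (psi : ordered_functor D E)
  (phi : ordered_functor C D) : is_ordered_functor (fun x => psi (phi x)).
Proof.
have [phiD phiR phiM phi_le] := of_axioms phi.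
have [psiD psiR psiM psi_le] := of_axioms psi.
split=> [x|x|x y xy /phiM/psiM//|x y /phi_le/psi_le//].
- by rewrite phiD psiD.
- by rewrite phiR psiR.
Qed.

Definition ofun_id (C : licat) : ordered_functor C C :=
  OrderedFunctor (of_id_axioms C).

Definition ofun_comp (C D E : licat) (psi : ordered_functor D E)
  (phi : ordered_functor C D) : ordered_functor C E :=
  OrderedFunctor (of_comp_axioms psi phi).

Lemma ofun_eq (C D : licat) (phi psi : ordered_functor C D) :
  of_fun phi = of_fun psi -> phi = psi.
Proof.
case: phi psi => [f Hf] [g Hg] /= efg; case: g / efg Hg => Hg.
by rewrite (Prop_irrelevance Hf Hg).
Qed.

Definition liCAT_of : Category :=
  @MkCategory licat ordered_functor ofun_id ofun_comp
    (fun C D f => @ofun_eq C D (ofun_comp f (ofun_id C)) f erefl)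
    (fun C D f => @ofun_eq C D (ofun_comp (ofun_id D) f) f erefl)
    (fun C D E F h g f => @ofun_eq C F (ofun_comp h (ofun_comp g f))
                            (ofun_comp (ofun_comp h g) f) erefl).

(* Main.v *)
Require Import Defs.
From mathcomp Require Import all_boot boolp.

Set Implicit Arguments.
Unset Strict Implicit.
Unset Printing Implicit Defensive.

(** The isomorphism keeps carriers and the functions underlying morphisms, so
    the whole content lies in translating the structure.

    From a restriction semigroupoid [S] one gets a category by remembering only
    the products [s t] with [s^* = t^+]: the domain is [s^*], the range [s^+],
    the objects are the projections, and the order is the natural one.
    Restriction and corestriction are multiplication by a projection.

    Conversely, in a locally inductive category [C] the product of [x] and [y]
    is the largest composite [x1 o y1] with [x1 <= x] and [y1 <= y].  As soon as
    one such composite exists, the local meet [e] of [D x] and [R y] exists and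
    [(x|e) o (e|y)] is the largest one ([is_prod_exists]).  Describing the
    product by this maximality, rather than by the formula, makes associativity
    nearly formal: both [(x y) z] and [x (y z)] are the largest composite
    [x1 o y1 o z1] of elements below [x], [y], [z] ([below3P]), because an
    element below a composite is itself a composite of smaller factors
    ([le_comp_factor]).  The definedness clause for [x y] and [y z] is where
    transitivity of having a common lower bound is used ([compat_trans]).

    The constructions are mutually inverse.  In [S] the product [x y] equals
    [(x y^+) (x^* y)], a product of composable elements below [x] and [y], and
    multiplication is monotone, so [x y] is the largest such composite
    ([is_prod_rsgpd]).  In [C], if [D x = R y] then [x o y] is trivially the
    largest composite ([is_prod_comp]), and [R x * y = x] says that [x] is a
    corestriction of [y], that is, [x <= y] ([li_leP]).

    A premorphism [phi] preserves composition because [phi (s t)] lies below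
    [phi s * phi t] with the same range, hence equals it; an ordered functor
    satisfies the premorphism inequality because it sends composites below
    [x], [y] to composites below their images.

    Both kinds of structure are self-dual (exchange [+] with [*], and [D] with
    [R]), so every one-sided fact is proved once and transported to the
    opposite structure. *)

(** * Functional relations as partial functions *)

Definition the_only (X : Type) (P : X -> Prop) : option X :=
  if pselect (exists x, P x) is left h then Some (projT1 (cid h)) else None.

Lemma the_onlyP (X : Type) (P : X -> Prop) (x : X) :
  (forall y z, P y -> P z -> y = z) -> the_only P = Some x <-> P x.
Proof.
move=> uniqP; rewrite /the_only; case: pselect => [h|nP].
  case: cid => y Py /=; split=> [[<-]//|Px]; congr Some; exact: uniqP.
by split=> // Px; case: nP; exists x.
Qed.

Lemma eq_option (X : Type) (o o' : option X) :
  (forall x, o = Some x <-> o' = Some x) -> o = o'.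
Proof.
case: o o' => [x|] [y|] // h; first by rewrite ((h x).1 erefl).
  by have := (h x).1 erefl.
by have := (h y).2 erefl.
Qed.

(** * Associativity in a semigroupoid *)

Section SemigroupoidTheory.
Variables (S : Type) (mul : S -> S -> option S).
Hypothesis sg : is_semigroupoid mul.

Lemma sg_assoc s t r st tr : mul s t = Some st -> mul t r = Some tr ->
  exists2 u, mul st r = Some u & mul s tr = Some u.
Proof.
move=> e1 e2; have [|a [b [u []]]] := sg (s := s) (t := t) (r := r).
  by left; split; [exists st|exists tr].
by rewrite e1 e2 => -[<-] [<-]; exists u.
Qed.

Lemma sg_assocl s t r st u : mul s t = Some st -> mul st r = Some u ->
  exists2 tr, mul t r = Some tr & mul s tr = Some u.
Proof.
move=> e1 e2; have [|a [b [v []]]] := sg (s := s) (t := t) (r := r).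
  by right; left; exists st; split=> //; exists u.
by rewrite e1 => -[<-] e3; rewrite e2 => -[<-] e4; exists b.
Qed.

Lemma sg_assocr s t r tr u : mul t r = Some tr -> mul s tr = Some u ->
  exists2 st, mul s t = Some st & mul st r = Some u.
Proof.
move=> e1 e2; have [|a [b [v []]]] := sg (s := s) (t := t) (r := r).
  by right; right; exists tr; split=> //; exists u.
by rewrite e1 => e3 [<-] e4; rewrite e2 => -[->]; exists a.
Qed.
End SemigroupoidTheory.

(** * Restriction semigroupoids *)

Lemma rsgpd_op_axioms (S : rsgpd) :
  is_restriction_semigroupoid (fun s t : S => rs_mul t s)
    (@rs_star S) (@rs_plus S).
Proof.
have [sg plusL starR plusC starC plusM starM ampL ampR plusK starK] :=
  rs_axioms S.
split.
- move=> s t r H; have [|a [b [u []]]] := sg r t s; last by exists b, a, u.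
  by case: H => [[]|[]]; [left|right; right|right; left].
- exact: starR.
- exact: plusL.
- by move=> s t u; exact: starC.
- by move=> s t u; exact: plusC.
- by move=> s t u ; exact: starM.
- by move=> s t u ; exact: plusM.
- by move=> s t st; exact: ampR.
- by move=> s t st; exact: ampL.
- exact: starK.
- exact: plusK.
Qed.

Definition rsgpd_op (S : rsgpd) : rsgpd := RSgpd (rsgpd_op_axioms S).

Section RestrictionSemigroupoidTheory.
Variable S : rsgpd.
Implicit Types s t r u e : S.

Let sgS : is_semigroupoid (@rs_mul S) := rs_semigroupoid (rs_axioms S).

Lemma rs_star_plus s : rs_star (rs_plus s) = rs_plus s.
Proof. by rewrite -(rs_plusK (rs_axioms S)). Qed.

Lemma rs_plus_star s : rs_plus (rs_star s) = rs_star s.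
Proof. by rewrite -(rs_starK (rs_axioms S)). Qed.

Lemma rs_plus_plus s : rs_plus (rs_plus s) = rs_plus s.
Proof. by have := rs_plus_star (rs_plus s); rewrite !rs_star_plus. Qed.

Lemma rs_star_proj e : rs_plus e = e -> rs_star e = e.
Proof. by move=> <-; rewrite rs_star_plus. Qed.

Lemma rs_mul_proj e : rs_plus e = e -> rs_mul e e = Some e.
Proof. by move=> pe; have := rs_plusL (rs_axioms S) e; rewrite pe. Qed.

(** The ample identity [a^* t = t (a t)^*] at [a = s^+] reads [s = t s^*]; with
    its dual it makes the order self-dual. *)
Lemma rs_le_star s t : rs_le s t -> rs_mul t (rs_star s) = Some s.
Proof.
rewrite /rs_le => e; have [u] := rs_ampleR (rs_axioms S) e.
by rewrite rs_star_plus e => -[<-].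
Qed.

Lemma rs_le_projL e t s : rs_plus e = e -> rs_mul e t = Some s -> rs_le s t.
Proof. by move=> <-; exact: rs_le_plusL. Qed.

(** Both sides of the identity [(s t)^+ = (s t^+)^+] equal [(s t)^+ s^+]. *)
Lemma rs_plus_mul s t st u : rs_mul s t = Some st ->
  rs_mul s (rs_plus t) = Some u -> rs_plus st = rs_plus u.
Proof.
have [_ plusL _ plusC _ plusM _ ampL _ _ _] := rs_axioms S.
move=> est eu.
have [u' ] := ampL _ _ _ est; rewrite eu => -[<-] {u'} e1.
have [w ew _] := sg_assocr sgS (plusL s) e1.
have [v] := plusM _ _ _ ew; rewrite e1 => -[<-] <-.
have [v'] := plusM _ _ _ (plusC _ _ _ ew).
have [p] := sg_assocl sgS (plusL s) est.
by rewrite est => -[<-] es; rewrite es => -[<-].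
Qed.

Lemma rs_comp_def s t : rs_star s = rs_plus t -> defined (rs_mul s t).
Proof.
have [_ plusL starR _ _ _ _ _ _ _ _] := rs_axioms S.
move=> est; have := plusL t; rewrite -est => e.
by have [u e1 _] := sg_assoc sgS (starR s) e; exists u.
Qed.

Lemma rs_plus_comp s t st : rs_mul s t = Some st -> rs_star s = rs_plus t ->
  rs_plus st = rs_plus s.
Proof.
move=> e est; apply: (rs_plus_mul e).
by rewrite -est; exact: rs_starR (rs_axioms S) s.
Qed.

Lemma rs_le_plus s t : rs_le s t -> rs_le (rs_plus s) (rs_plus t).
Proof.
have [_ plusL _ _ _ plusM _ _ _ _ _] := rs_axioms S.
rewrite /rs_le => st; have [w ew _] := sg_assocr sgS (plusL t) st.
have [v] := plusM _ _ _ ew; rewrite st => -[<-] ws.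
by rewrite rs_plus_plus ew ws.
Qed.

Lemma rs_le_plus_inj s t : rs_le s t -> rs_plus s = rs_plus t -> s = t.
Proof.
by rewrite /rs_le => + e; rewrite e (rs_plusL (rs_axioms S)) => -[].
Qed.

Lemma rs_le_anti s t : rs_le s t -> rs_le t s -> s = t.
Proof.
move=> st ts; apply: (rs_le_plus_inj st).
have := rs_le_plus ts; have := rs_le_plus st.
by rewrite /rs_le !rs_plus_plus => /(rs_plusC (rs_axioms S)) -> [].
Qed.
End RestrictionSemigroupoidTheory.

Lemma rs_le_op (S : rsgpd) (s t : S) : @rs_le (rsgpd_op S) s t <-> rs_le s t.
Proof. by split; [exact: (@rs_le_star (rsgpd_op S))|exact: rs_le_star]. Qed.

Section RestrictionSemigroupoidOrder.
Variable S : rsgpd.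
Implicit Types s t r u e : S.

Let sgS : is_semigroupoid (@rs_mul S) := rs_semigroupoid (rs_axioms S).

Lemma rs_le_projR e t s : rs_plus e = e -> rs_mul t e = Some s -> rs_le s t.
Proof.
move=> pe ets; apply/rs_le_op.
exact: (@rs_le_projL (rsgpd_op S) e _ _ (rs_star_proj pe)) ets.
Qed.

(** If [x = x^+ y] and [x' = y' x'^*], then [x x' = x^+ (y y') x'^*]. *)
Lemma rs_mul_mono x y x' y' u : rs_le x y -> rs_le x' y' ->
  rs_mul x x' = Some u -> exists2 v, rs_mul y y' = Some v & rs_le u v.
Proof.
move=> xy x'y' e; have [w e1 e2] := sg_assocl sgS xy e.
have [v e3 e4] := sg_assocr sgS (rs_le_star x'y') e1.
exists v => //; apply: (@rs_le_trans _ w); first exact: rs_le_plusL e2.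
exact: rs_le_projR (rs_plus_star _) e4.
Qed.

Lemma rs_restriction s e : rs_plus e = e -> rs_le e (rs_star s) ->
  exists2 z, rs_mul s e = Some z & rs_star z = e.
Proof.
move=> pe; rewrite /rs_le pe => le_e.
have le_e' : rs_mul (rs_star s) e = Some e.
  have := rs_plusC (rs_axioms S) (s := e) (t := rs_star s) (u := e).
  by rewrite rs_plus_star pe; apply.
have [z ez _] := sg_assoc sgS (rs_starR (rs_axioms S) s) le_e'.
exists z => //; rewrite -[RHS](rs_star_proj pe).
exact: (@rs_plus_mul (rsgpd_op S)) ez le_e'.
Qed.
End RestrictionSemigroupoidOrder.

(** * From restriction semigroupoids to locally inductive categories *)

Section CategoryOfRsgpd.
Variable S : rsgpd.
Implicit Types s t r u e : S.

Let sgS : is_semigroupoid (@rs_mul S) := rs_semigroupoid (rs_axioms S).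

Definition rs_proj e : Prop := rs_plus e = e.

Definition rs_comp s t : option S :=
  if pselect (rs_star s = rs_plus t) is left _ then rs_mul s t else None.

Lemma rs_compP s t u :
  rs_comp s t = Some u <-> rs_star s = rs_plus t /\ rs_mul s t = Some u.
Proof. by rewrite /rs_comp; case: pselect => h; split=> // -[]. Qed.

Lemma rs_compE s t : rs_star s = rs_plus t -> rs_comp s t = rs_mul s t.
Proof. by rewrite /rs_comp; case: pselect. Qed.

Lemma rs_star_comp s t st : rs_comp s t = Some st -> rs_star st = rs_star t.
Proof. by move=> /rs_compP[e /(@rs_plus_comp (rsgpd_op S))]; apply. Qed.

Lemma rs_category_axioms :
  is_category rs_proj (@rs_star S) (@rs_plus S) rs_comp.
Proof.
split.
- exact: rs_plus_star.
- exact: rs_plus_plus.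
- move=> x y; split=> [[u /rs_compP[]]//|e].
  by rewrite rs_compE //; exact: rs_comp_def.
- exact: rs_star_comp.
- by move=> x y u /rs_compP[] + /rs_plus_comp; move=> /[swap] /[apply].
- move=> x y z xy yz exy eyz.
  have Dxy := rs_star_comp exy.
  have [exy1 exy2] := (rs_compP _ _ _).1 exy.
  have [eyz1 eyz2] := (rs_compP _ _ _).1 eyz.
  have Ryz := rs_plus_comp eyz2 eyz1.
  rewrite !rs_compE ?Dxy ?Ryz //.
  by have [u -> ->] := sg_assoc sgS exy2 eyz2.
- by move=> e; exact: rs_star_proj.
- by [].
- move=> x e pe De; rewrite rs_compE -?De ?(rs_starR (rs_axioms S)) //.
  by rewrite rs_plus_star.
- move=> e y pe Re; rewrite rs_compE; last by rewrite rs_star_proj.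
  by rewrite Re (rs_plusL (rs_axioms S)).
Qed.

Definition rs_meet (e f : {x : S | rs_proj x}) : option {x : S | rs_proj x} :=
  the_only (fun g => rs_mul (sval e) (sval f) = Some (sval g)).

Lemma rs_meetP (e f g : {x : S | rs_proj x}) :
  rs_meet e f = Some g <-> rs_mul (sval e) (sval f) = Some (sval g).
Proof.
by apply: the_onlyP => -[g1 p1] [g2 p2] /= -> [eg]; exact: eq_exist.
Qed.

Lemma rs_mul_projs e f u : rs_proj e -> rs_proj f -> rs_mul e f = Some u ->
  rs_proj u.
Proof.
move=> pe pf; rewrite -{1}pe -{1}pf => /(rs_plusM (rs_axioms S))[v _ ->].
exact: rs_plus_plus.
Qed.

Lemma rs_meet_axioms : is_local_meet_semilattice rs_meet.
Proof.
have mk (e f : {x : S | rs_proj x}) u : rs_mul (sval e) (sval f) = Some u ->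
    exists2 g, u = sval g & rs_meet e f = Some g.
  case: e f => [e pe] [f pf] /= euf.
  by exists (exist _ u (rs_mul_projs pe pf euf)) => //; apply/rs_meetP.
split.
- move=> e f g H.
  have [|a [b [u []]]] := sgS (s := sval e) (t := sval f) (r := sval g).
    case: H => [[[a /rs_meetP ea] [b /rs_meetP eb]]|
      [[a [/rs_meetP ea [b /rs_meetP eb]]]|
       [a [/rs_meetP ea [b /rs_meetP eb]]]]].
    + by left; split; [exists (sval a)|exists (sval b)].
    + by right; left; exists (sval a); split=> //; exists (sval b).
    + by right; right; exists (sval a); split=> //; exists (sval b).
  move=> /mk[a' -> ea] /mk[b' -> eb] /mk[u' -> eu] /rs_meetP ev.
  by exists a', b', u'.
- by move=> [e pe]; apply/rs_meetP; exact: rs_mul_proj.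
- move=> [e pe] [f pf] [g pg] /rs_meetP /= h; apply/rs_meetP => /=.
  by have := rs_plusC (rs_axioms S) (s := e) (t := f); rewrite pe pf; apply.
Qed.

Lemma rs_li_restriction s e : rs_proj e -> rs_le e (rs_star s) ->
  exists! z, rs_le z s /\ rs_star z = e.
Proof.
move=> pe le_e; have [z ez Dz] := rs_restriction pe le_e.
exists z; split; first by split=> //; exact: rs_le_projR ez.
by move=> w [/rs_le_star + Dw]; rewrite Dw ez => -[].
Qed.
End CategoryOfRsgpd.

Lemma rs_li_axioms (S : rsgpd) :
  is_locally_inductive (@rs_proj S) (@rs_star S) (@rs_plus S)
    (@rs_comp S) (@rs_le S).
Proof.
split.
- exact: rs_category_axioms.
- split; [exact: rs_le_refl| |exact: rs_le_anti].
  by move=> s t r; exact: rs_le_trans.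
- by move=> x y /rs_le_op/(@rs_le_plus (rsgpd_op S))/rs_le_op.
- exact: rs_le_plus.
- move=> x y x' y' xx' yy' lexy lexy' /rs_compP[_ exx'] /rs_compP[_ eyy'].
  by have [v] := rs_mul_mono lexy lexy' exx'; rewrite eyy' => -[<-].
- exact: rs_li_restriction.
- move=> x e pe /rs_le_op le_e.
  have [z [[/rs_le_op zx Rz] uz]] :=
    @rs_li_restriction (rsgpd_op S) x e (rs_star_proj pe) le_e.
  by exists z; split=> // w [wx Rw]; apply: uz; split=> //; apply/rs_le_op.
- exists (@rs_meet S); first exact: rs_meet_axioms.
  by move=> [e pe] [f pf]; rewrite rs_meetP /rs_le /= pe.
Qed.

Definition licat_of_rsgpd (S : rsgpd) : licat := LICat (rs_li_axioms S).

(** For composable [s], [t] the elements [phi (s t)] and [phi s * phi t] are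
    comparable and have the same [+], so the premorphism inequality is an
    equality. *)
Lemma vpm_comp_strict (S T : rsgpd) (phi : vpremorphism S T) (s t u : S) :
  rs_comp s t = Some u -> rs_comp (phi s) (phi t) = Some (phi u).
Proof.
have [phiM phi_plus phi_star] := vpm_axioms phi.
move=> /rs_compP[est /[dup] esu /phiM[v ev le_uv]].
have est' : rs_star (phi s) = rs_plus (phi t) by rewrite -phi_star est.
rewrite rs_compE // ev; congr Some; apply/esym/rs_le_plus_inj => //.
by rewrite (rs_plus_comp ev est') -!phi_plus (rs_plus_comp esu est).
Qed.

Lemma ofun_of_vpm_axioms (S T : rsgpd) (phi : vpremorphism S T) :
  @is_ordered_functor (licat_of_rsgpd S) (licat_of_rsgpd T) phi.
Proof.
have [_ phi_plus phi_star] := vpm_axioms phi.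
split=> //; [exact: vpm_comp_strict|exact: vpm_le].
Qed.

Definition ofun_of_vpm (S T : rsgpd) (phi : vpremorphism S T) :
    ordered_functor (licat_of_rsgpd S) (licat_of_rsgpd T) :=
  OrderedFunctor (ofun_of_vpm_axioms phi).

(** * Locally inductive categories *)

Section LocalMeet.
Variables (X : Type) (meet : X -> X -> option X).
Hypothesis lms : is_local_meet_semilattice meet.

Lemma lms_lbr e f u : meet e f = Some u -> meet u f = Some u.
Proof.
move=> eu; have := sg_assoc (lms_semigroupoid lms) eu (lms_idem lms f).
by rewrite eu => -[v -> [->]].
Qed.

Lemma lms_lbl e f u : meet e f = Some u -> meet u e = Some u.
Proof. by move=> /(lms_comm lms)/lms_lbr. Qed.

(** A common lower bound forces the meet to be defined, by the third clause of
    associativity applied to [g = g e] and [g f = g]. *)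
Lemma lms_glb g e f : meet g e = Some g -> meet g f = Some g ->
  exists2 u, meet e f = Some u & meet g u = Some g.
Proof. by move=> ge gf; apply: (sg_assocl (lms_semigroupoid lms) ge gf). Qed.
End LocalMeet.

Section LicatOrder.
Variable C : licat.
Implicit Types x y z w e f g : C.

Let LI := li_axioms C.
Let CC := li_category LI.

Lemma li_le_refl x : li_le x x.
Proof. by case: (li_order LI) => refl _ _; exact: refl. Qed.

Lemma li_le_trans y x z : li_le x y -> li_le y z -> li_le x z.
Proof. by case: (li_order LI) => _ trans _; exact: trans. Qed.

Lemma li_le_anti x y : li_le x y -> li_le y x -> x = y.
Proof. by case: (li_order LI) => _ _; apply. Qed.

Lemma li_DD x : li_D (li_D x) = li_D x.
Proof. by apply: (cat_Did CC); exact: (cat_D0 CC). Qed.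

Lemma li_DR x : li_D (li_R x) = li_R x.
Proof. by apply: (cat_Did CC); exact: (cat_R0 CC). Qed.

Lemma li_RD x : li_R (li_D x) = li_D x.
Proof. by apply: (cat_Rid CC); exact: (cat_D0 CC). Qed.

Lemma li_RR x : li_R (li_R x) = li_R x.
Proof. by apply: (cat_Rid CC); exact: (cat_R0 CC). Qed.

Lemma li_comp_defP x y : li_D x = li_R y -> exists z, li_comp x y = Some z.
Proof. by move=> /(cat_comp_def CC). Qed.

Lemma li_comp_eq x y z : li_comp x y = Some z -> li_D x = li_R y.
Proof. by move=> e; apply/(cat_comp_def CC); exists z. Qed.

(** [x1] and the restriction of [x2] to [D x1] are both restrictions of [x]
    to [D x1]. *)
Lemma li_le_of_D x x1 x2 : li_le x1 x -> li_le x2 x ->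
  li_le (li_D x1) (li_D x2) -> li_le x1 x2.
Proof.
move=> le1 le2 leD.
have [z [[zx2 Dz] _]] := li_restriction LI (cat_D0 CC x1) leD.
have [w [_ uniq_w]] := li_restriction LI (cat_D0 CC x1) (li_leD LI le1).
have wx1 : w = x1 by exact: uniq_w.
have wz : w = z by apply: uniq_w; split=> //; exact: li_le_trans le2.
by rewrite -wx1 wz.
Qed.

Lemma li_obj_down x e : li_C0 e -> li_le x e -> li_C0 x.
Proof.
move=> e0 xe; have Dxe : li_le (li_D x) e.
  by rewrite -(cat_Did CC e0); exact: (li_leD LI).
suff -> : x = li_D x by exact: (cat_D0 CC).
by apply: li_le_anti; apply: (@li_le_of_D e) => //; rewrite li_DD;
  exact: li_le_refl.
Qed.

(** Restrict [b] to [D w], then [a] to the range of that restriction: the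
    composite is the restriction of [a o b] to [D w], which is [w]. *)
Lemma le_comp_factor a b p w : li_comp a b = Some p -> li_le w p ->
  exists a1 b1, [/\ li_le a1 a, li_le b1 b & li_comp a1 b1 = Some w].
Proof.
move=> ep wp; have leD := li_leD LI wp.
have [b1 [[b1b Db1] _]] : exists! z, li_le z b /\ li_D z = li_D w.
  apply: (li_restriction LI (cat_D0 CC w)).
  by rewrite -(cat_Dcomp CC ep).
have [a1 [[a1a Da1] _]] : exists! z, li_le z a /\ li_D z = li_R b1.
  apply: (li_restriction LI (cat_R0 CC b1)).
  by rewrite (li_comp_eq ep); exact: (li_leR LI).
have [v ev] := li_comp_defP Da1.
have vp : li_le v p := li_le_comp LI a1a b1b ev ep.
have Dv : li_D v = li_D w by rewrite (cat_Dcomp CC ev).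
exists a1, b1; split=> //; rewrite ev; congr Some.
by apply: li_le_anti; apply: (@li_le_of_D p) => //; rewrite Dv;
  exact: li_le_refl.
Qed.

Definition compat e f : Prop :=
  exists g, [/\ li_C0 g, li_le g e & li_le g f].

Lemma li_meet_exists e f : li_C0 e -> li_C0 f -> compat e f ->
  exists m, [/\ li_C0 m, li_le m e, li_le m f &
    forall g, li_C0 g -> li_le g e -> li_le g f -> li_le g m].
Proof.
move=> e0 f0 [g [g0 ge gf]]; have [meet lms leP] := li_objects LI.
have glb h (h0 : li_C0 h) : li_le h e -> li_le h f ->
    exists2 u, meet (exist _ e e0) (exist _ f f0) = Some u &
               li_le h (sval u).
  move=> he hf.
  have [u eu hu] := lms_glb lms ((leP (exist _ h h0) (exist _ e e0)).1 he)
                           ((leP (exist _ h h0) (exist _ f f0)).1 hf).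
  by exists u => //; exact: (leP (exist _ h h0) u).2 hu.
have [u eu _] := glb g g0 ge gf.
exists (sval u); split.
- exact: svalP.
- exact: (leP u (exist _ e e0)).2 (lms_lbl lms eu).
- exact: (leP u (exist _ f f0)).2 (lms_lbr lms eu).
- by move=> h h0 he hf; have [v] := glb h h0 he hf; rewrite eu => -[<-].
Qed.

(** If [e f] and [f g] are defined then so is [(e f) g], which lies below [e]
    and [g]. *)
Lemma compat_trans f e g : li_C0 e -> li_C0 f -> li_C0 g ->
  compat e f -> compat f g -> compat e g.
Proof.
move=> e0 f0 g0 [h [h0 he hf]] [k [k0 kf kg]].
have [meet lms leP] := li_objects LI.
pose E := exist _ e e0; pose F := exist _ f f0; pose G := exist _ g g0.
have [u eu _] := lms_glb lms ((leP (exist _ h h0) E).1 he)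
                             ((leP (exist _ h h0) F).1 hf).
have [v ev _] := lms_glb lms ((leP (exist _ k k0) F).1 kf)
                             ((leP (exist _ k k0) G).1 kg).
have [w ew _] := sg_assoc (lms_semigroupoid lms) eu ev.
exists (sval w); split; first exact: svalP.
  apply: (@li_le_trans (sval u)).
    exact: (leP w u).2 (lms_lbl lms ew).
  exact: (leP u E).2 (lms_lbl lms eu).
exact: (leP w G).2 (lms_lbr lms ew).
Qed.
End LicatOrder.

Lemma licat_op_axioms (C : licat) :
  is_locally_inductive (@li_C0 C) (@li_R C) (@li_D C)
    (fun x y => li_comp y x) (@li_le C).
Proof.
have [[D0 R0 cdef Dc Rc cA Did Rid cR cL] ord leD leR lec res cores obj] :=
  li_axioms C.
split=> //; last by move=> x y x' y' u v lexy lexy'; exact: lec lexy' lexy.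
split=> //.
- by move=> x y; split=> [/cdef|] // e; apply/cdef.
- by move=> x y u; exact: Rc.
- by move=> x y u; exact: Dc.
- by move=> x y z u v exy eyz; rewrite (cA _ _ _ _ _ eyz exy).
- by move=> x e e0 Re; exact: cL.
- by move=> e y e0 eD; exact: cR.
Qed.

Definition licat_op (C : licat) : licat := LICat (licat_op_axioms C).

Lemma li_le_of_R (C : licat) (x x1 x2 : C) : li_le x1 x -> li_le x2 x ->
  li_le (li_R x1) (li_R x2) -> li_le x1 x2.
Proof. exact: (@li_le_of_D (licat_op C)). Qed.

(** * Largest composites below two elements *)

Section Product.
Variable C : licat.
Implicit Types x y z w e f : C.

Let LI := li_axioms C.
Let CC := li_category LI.

Definition comp_below x y w : Prop :=
  exists x1 y1, [/\ li_le x1 x, li_le y1 y & li_comp x1 y1 = Some w].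

Definition is_prod x y z : Prop :=
  comp_below x y z /\ forall w, comp_below x y w -> li_le w z.

Lemma is_prod_uniq x y z z' : is_prod x y z -> is_prod x y z' -> z = z'.
Proof. by move=> [b m] [b' m']; apply: li_le_anti; [exact: m'|exact: m]. Qed.

Lemma comp_below_compat x y w : comp_below x y w -> compat (li_D x) (li_R y).
Proof.
move=> [x1 [y1 [x1x y1y ew]]]; exists (li_D x1); split.
- exact: (cat_D0 CC).
- exact: (li_leD LI).
- by rewrite (li_comp_eq ew); exact: (li_leR LI).
Qed.

(** The largest composite is [(x|e) o (e|y)], for [e] the meet of [D x] and
    [R y]. *)
Lemma is_prod_exists x y : compat (li_D x) (li_R y) -> exists z, is_prod x y z.
Proof.
move=> /(li_meet_exists (cat_D0 CC x) (cat_R0 CC y))[e [e0 eD eR glb]].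
have [x1 [[x1x Dx1] _]] := li_restriction LI e0 eD.
have [y1 [[y1y Ry1] _]] := li_corestriction LI e0 eR.
have [z ez] := li_comp_defP (etrans Dx1 (esym Ry1)).
exists z; split; first by exists x1, y1.
move=> w [x2 [y2 [x2x y2y ew]]]; have ew' := li_comp_eq ew.
have le_e : li_le (li_D x2) e.
  apply: glb; [exact: (cat_D0 CC)|exact: (li_leD LI)|].
  by rewrite ew'; exact: (li_leR LI).
apply: (li_le_comp LI _ _ ew ez).
  by apply: (li_le_of_D x2x x1x); rewrite Dx1.
by apply: (li_le_of_R y2y y1y); rewrite Ry1 -ew'.
Qed.

Lemma is_prod_comp x y z : li_comp x y = Some z -> is_prod x y z.
Proof.
move=> ez; split; first by exists x, y; split=> //; exact: li_le_refl.
by move=> w [x1 [y1 [x1x y1y ew]]]; exact: (li_le_comp LI x1x y1y).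
Qed.

(** A factor below an object is an object, so it does not change the other
    factor. *)
Lemma comp_below_objL e y w : li_C0 e ->
  comp_below e y w <-> li_le w y /\ li_le (li_R w) e.
Proof.
move=> e0; split=> [[a [b [ae bw ew]]]|[wy Re]].
  have a0 := li_obj_down e0 ae; have Da := cat_Did CC a0.
  have ea := li_comp_eq ew.
  move: ew; rewrite (cat_compL CC a0) -?ea // => -[<-].
  by rewrite -ea Da.
exists (li_R w), w; split=> //; apply: (cat_compL CC) => //.
exact: (cat_R0 CC).
Qed.
End Product.

Lemma comp_below_op (C : licat) (x y w : C) :
  @comp_below (licat_op C) x y w <-> comp_below y x w.
Proof. by split=> -[a [b [? ? ?]]]; exists b, a. Qed.

Lemma is_prod_op (C : licat) (x y z : C) :
  @is_prod (licat_op C) x y z <-> is_prod y x z.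
Proof.
by split=> -[/comp_below_op b m]; split=> // w /comp_below_op; exact: m.
Qed.

Lemma comp_below_objR (C : licat) (x e w : C) : li_C0 e ->
  comp_below x e w <-> li_le w x /\ li_le (li_D w) e.
Proof.
by move=> e0; rewrite -comp_below_op; exact: (@comp_below_objL (licat_op C)).
Qed.

Definition comp_below3 (C : licat) (x y z w : C) : Prop :=
  exists x1 y1 z1 a, [/\ li_le x1 x, li_le y1 y & li_le z1 z] /\
    li_comp x1 y1 = Some a /\ li_comp a z1 = Some w.

(** Triple composites do not depend on the bracketing, hence are self-dual;
    this turns every statement on [(x y) z] into one on [x (y z)]. *)
Lemma comp_below3_to_op (C : licat) (x y z w : C) :
  comp_below3 x y z w -> @comp_below3 (licat_op C) z y x w.
Proof.
move=> [x1 [y1 [z1 [a [[x1x y1y z1z] [ea ew]]]]]].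
have CC := li_category (li_axioms C).
have [b eb] : exists b, li_comp y1 z1 = Some b.
  by apply: li_comp_defP; rewrite -(cat_Dcomp CC ea) (li_comp_eq ew).
exists z1, y1, x1, b; split=> //; split=> //=.
by rewrite -(cat_compA CC ea eb).
Qed.

Lemma comp_below3_op (C : licat) (x y z w : C) :
  @comp_below3 (licat_op C) z y x w <-> comp_below3 x y z w.
Proof.
split; last exact: comp_below3_to_op.
exact: (@comp_below3_to_op (licat_op C)).
Qed.

(** Elements below [p = x' o y'] factor as [x1 o y1], so nothing is lost by
    multiplying [x] and [y] first. *)
Lemma below3P (C : licat) (x y z p w : C) : is_prod x y p ->
  comp_below p z w <-> comp_below3 x y z w.
Proof.
move=> [[x' [y' [x'x y'y ep]]] maxp]; split.
  move=> [p1 [z1 [p1p z1z ew]]].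
  have [x1 [y1 [x1x' y1y' ep1]]] := le_comp_factor ep p1p.
  exists x1, y1, z1, p1; split=> //.
  by split=> //; [exact: li_le_trans x'x|exact: li_le_trans y'y].
move=> [x1 [y1 [z1 [a [[x1x y1y z1z] [ea ew]]]]]].
by exists a, z1; split=> //; apply: maxp; exists x1, y1.
Qed.

Lemma is_prod3_exists (C : licat) (x y z w : C) : comp_below3 x y z w ->
  exists p u, [/\ is_prod x y p, is_prod p z u, comp_below3 x y z u &
    forall v, comp_below3 x y z v -> li_le v u].
Proof.
move=> /[dup] w3 [x1 [y1 [z1 [a [[x1x y1y z1z] [ea ew]]]]]].
have /comp_below_compat/is_prod_exists[p xyp] : comp_below x y a.
  by exists x1, y1.
have /comp_below_compat/is_prod_exists[u pzu] := (below3P z w xyp).2 w3.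
exists p, u; split=> //; first by apply/(below3P _ _ xyp); case: pzu.
by move=> v /(below3P _ _ xyp); case: pzu => _; apply.
Qed.

(** * From locally inductive categories to restriction semigroupoids *)

Section RsgpdOfCategory.
Variable C : licat.
Implicit Types x y z w s t u e f : C.

Let LI := li_axioms C.
Let CC := li_category LI.

Definition li_mul x y : option C := the_only (is_prod x y).

Lemma li_mulP x y z : li_mul x y = Some z <-> is_prod x y z.
Proof. by apply: the_onlyP => u v; exact: is_prod_uniq. Qed.

Lemma li_semigroupoid : is_semigroupoid li_mul.
Proof.
move=> x y z H.
suff [w w3] : exists w, comp_below3 x y z w.
  have [p [u [xyp pzu u3 maxu]]] := is_prod3_exists w3.
  have [q [u' [/is_prod_op yzq /is_prod_op xqu' u3' maxu']]] :=
    is_prod3_exists (comp_below3_to_op w3).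
  have eu : u' = u.
    apply: li_le_anti; first by apply: maxu; exact/comp_below3_op.
    by apply: maxu'; exact/comp_below3_op.
  by exists p, q, u; split; apply/li_mulP => //; rewrite -eu.
case: H => [[[p /li_mulP xyp] [q /li_mulP yzq]]|
           [[p [/li_mulP xyp [u /li_mulP pzu]]]|
            [q [/li_mulP yzq [u /li_mulP xqu]]]]].
(* [D p <= D y], so [D p] is linked to [R z] through [D y]. *)
- have pz : compat (li_D p) (li_R z).
    apply: (@compat_trans C (li_D y)); try exact: (cat_D0 CC);
      try exact: (cat_R0 CC); last exact: (comp_below_compat yzq.1).
    have [[x1 [y1 [_ y1y ep]]] _] := xyp.
    exists (li_D p); split; [exact: (cat_D0 CC)|exact: li_le_refl|].
    by rewrite (cat_Dcomp CC ep); exact: (li_leD LI).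
  have [u pzu] := is_prod_exists pz.
  by exists u; exact: (below3P z u xyp).1 pzu.1.
- by exists u; exact: (below3P z u xyp).1 pzu.1.
- exists u; apply: (comp_below3_op x y z u).1.
  apply: (@below3P (licat_op C) z y x q u ((is_prod_op z y q).2 yzq)).1.
  exact: ((is_prod_op q x u).2 xqu).1.
Qed.

Lemma li_mul_RL s : li_mul (li_R s) s = Some s.
Proof.
by apply/li_mulP/is_prod_comp/(cat_compL CC) => //; exact: (cat_R0 CC).
Qed.

Lemma li_mul_RC s t u :
  li_mul (li_R s) (li_R t) = Some u -> li_mul (li_R t) (li_R s) = Some u.
Proof.
have sym e f w : li_C0 e -> li_C0 f -> comp_below e f w -> comp_below f e w.
  move=> e0 f0 /(comp_below_objL _ _ e0)[wf Re].
  apply/(comp_below_objR _ _ e0); split=> //.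
  have w0 := li_obj_down f0 wf.
  by rewrite (cat_Did CC w0) -(cat_Rid CC w0).
have [s0 t0] := (cat_R0 CC s, cat_R0 CC t).
move=> /li_mulP[b m]; apply/li_mulP; split; first exact: sym.
by move=> w /(sym _ _ _ t0 s0); exact: m.
Qed.

(** [R s * t] is the corestriction [u|t] to the object [u = R s * R t]. *)
Lemma li_mul_RM s t u : li_mul (li_R s) (li_R t) = Some u ->
  exists2 v, li_mul (li_R s) t = Some v & u = li_R v.
Proof.
have s0 := cat_R0 CC s; have t0 := cat_R0 CC t.
move=> /li_mulP[/(comp_below_objL _ _ s0)[ut us] max].
have u0 := li_obj_down t0 ut.
have [v [[vt Rv] _]] := li_corestriction LI u0 ut.
exists v => //; apply/li_mulP; split.
  by apply/(comp_below_objL _ _ s0); rewrite Rv -{1}(cat_Rid CC u0).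
move=> w /(comp_below_objL _ _ s0)[wt Rw]; apply: (li_le_of_R wt vt).
rewrite Rv; apply/max/(comp_below_objL _ _ s0); rewrite li_RR; split=> //.
exact: (li_leR LI).
Qed.

(** Both products equal the left factor [s1] of the largest composite
    [s1 o t1] below [s] and [t]: it is the largest [w <= s] with
    [D w <= R t], and also the restriction of [s] with range [R (s t)]. *)
Lemma li_mul_ampleL s t st : li_mul s t = Some st ->
  exists2 u, li_mul s (li_R t) = Some u & li_mul (li_R st) s = Some u.
Proof.
move=> /li_mulP[[s1 [t1 [s1s t1t est]]] max]; exists s1; apply/li_mulP; split.
- apply/(comp_below_objR _ _ (cat_R0 CC t)); split=> //.
  by rewrite (li_comp_eq est); exact: (li_leR LI).
- move=> w /(comp_below_objR _ _ (cat_R0 CC t))[ws Dw].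
  apply: (li_le_of_R ws s1s); rewrite -(cat_Rcomp CC est).
  have [t2 [[t2t Rt2] _]] := li_corestriction LI (cat_D0 CC w) Dw.
  have [v ev] := li_comp_defP (esym Rt2).
  rewrite -(cat_Rcomp CC ev); apply/(li_leR LI)/max; by exists w, t2.
- apply/(comp_below_objL _ _ (cat_R0 CC st)); split=> //.
  by rewrite (cat_Rcomp CC est); exact: li_le_refl.
- move=> w /(comp_below_objL _ _ (cat_R0 CC st))[ws Rw].
  by apply: (li_le_of_R ws s1s); rewrite -(cat_Rcomp CC est).
Qed.
End RsgpdOfCategory.

Lemma li_mul_op (C : licat) (x y : C) : @li_mul (licat_op C) x y = li_mul y x.
Proof.
apply: eq_option => z; apply: iff_trans (@li_mulP (licat_op C) x y z) _.
exact: iff_trans (is_prod_op x y z) (iff_sym (@li_mulP C y x z)).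
Qed.

Lemma li_rs_axioms (C : licat) :
  is_restriction_semigroupoid (@li_mul C) (@li_R C) (@li_D C).
Proof.
split.
- exact: li_semigroupoid.
- exact: li_mul_RL.
- by move=> s; rewrite -li_mul_op; exact: (@li_mul_RL (licat_op C)).
- exact: li_mul_RC.
- by move=> s t u; rewrite -!(@li_mul_op C); exact: (@li_mul_RC (licat_op C)).
- exact: li_mul_RM.
- move=> s t u; rewrite -li_mul_op => e.
  have [v ev ->] := @li_mul_RM (licat_op C) t s u e.
  by exists v => //; rewrite -li_mul_op.
- exact: li_mul_ampleL.
- move=> s t st; rewrite -li_mul_op => e.
  have [u] := @li_mul_ampleL (licat_op C) t s st e.
  by rewrite !li_mul_op; exists u.
- by move=> s; rewrite li_DR.
- by move=> s; rewrite li_RD.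
Qed.

Definition rsgpd_of_licat (C : licat) : rsgpd := RSgpd (li_rs_axioms C).

(** [R x * y] is the largest [w <= y] with [R w <= R x]. *)
Lemma li_leP (C : licat) (x y : C) :
  @rs_le (rsgpd_of_licat C) x y <-> li_le x y.
Proof.
rewrite /rs_le /= li_mulP; have R0 := cat_R0 (li_category (li_axioms C)) x.
split=> [[/(comp_below_objL _ _ R0)[]]//|xy].
split; first by apply/(comp_below_objL _ _ R0); split=> //; exact: li_le_refl.
by move=> w /(comp_below_objL _ _ R0)[wy Rw]; exact: li_le_of_R wy xy Rw.
Qed.

Lemma vpm_of_ofun_axioms (C D : licat) (phi : ordered_functor C D) :
  @is_vpremorphism (rsgpd_of_licat C) (rsgpd_of_licat D) phi.
Proof.
have [phiD phiR phiM phi_le] := of_axioms phi.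
split=> //= s t st /li_mulP[[s1 [t1 [s1s t1t est]]] _].
have b : comp_below (phi s) (phi t) (phi st).
  by exists (phi s1), (phi t1); split;
    [exact: phi_le|exact: phi_le|exact: phiM].
have [u pu] := is_prod_exists (comp_below_compat b).
by exists u; [exact/li_mulP|apply/li_leP; exact: pu.2].
Qed.

Definition vpm_of_ofun (C D : licat) (phi : ordered_functor C D) :
    vpremorphism (rsgpd_of_licat C) (rsgpd_of_licat D) :=
  VPremorphism (vpm_of_ofun_axioms phi).

(** * The constructions are mutually inverse on objects *)

Lemma rsgpd_eq (S : rsgpd) (mul' : S -> S -> option S)
    (ax : is_restriction_semigroupoid mul' (@rs_plus S) (@rs_star S)) :
  @rs_mul S = mul' -> RSgpd ax = S.
Proof.
case: S mul' ax => X mul plus star axS /= mul' ax e; subst mul'.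
by rewrite (Prop_irrelevance ax axS).
Qed.

Lemma licat_eq (C : licat) (C0' : C -> Prop) (comp' : C -> C -> option C)
    (le' : C -> C -> Prop)
    (ax : is_locally_inductive C0' (@li_D C) (@li_R C) comp' le') :
  @li_C0 C = C0' -> @li_comp C = comp' -> @li_le C = le' -> LICat ax = C.
Proof.
case: C C0' comp' le' ax => X C0 D R comp le axC /= C0' comp' le' ax
  e1 e2 e3; subst C0' comp' le'.
by rewrite (Prop_irrelevance ax axC).
Qed.

(** The product factors as [s t = (s t^+) (s^* t)]; the two factors lie below
    [s] and [t], and both [(s t^+)^*] and [(s^* t)^+] equal [s^* t^+]. *)
Lemma rs_mul_factor (S : rsgpd) (s t u : S) : rs_mul s t = Some u ->
  @comp_below (licat_of_rsgpd S) s t u.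
Proof.
have [sg plusL starR _ _ plusM starM _ _ _ _] := rs_axioms S.
move=> eu; have [p ep pt] := sg_assocr sg (plusL t) eu.
have [e ee _] := sg_assocl sg (starR s) ep.
have [p'] : exists2 v, rs_mul s (rs_plus t) = Some v & e = rs_star v.
  by rewrite -(rs_star_plus t); apply: starM; rewrite rs_star_plus.
rewrite ep => -[<-] ep_star.
have [q eq eq_plus] : exists2 v, rs_mul (rs_star s) t = Some v & e = rs_plus v.
  by rewrite -(rs_plus_star s); apply: plusM; rewrite rs_plus_star.
have sq : rs_le q t := rs_le_projL (rs_plus_star s) eq.
have [q'] := rs_ampleR (rs_axioms S) eu; rewrite eq => -[<-] tu.
exists p, q; split=> //.
  exact: rs_le_projR (rs_plus_plus t) ep.
apply/rs_compP; split; first by rewrite -ep_star.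
by have [v] := sg_assocl sg pt (starR u); rewrite tu => -[<-].
Qed.

Lemma is_prod_rsgpd (S : rsgpd) (s t u : S) :
  rs_mul s t = Some u <-> @is_prod (licat_of_rsgpd S) s t u.
Proof.
have maxP v w : rs_mul s t = Some v ->
    @comp_below (licat_of_rsgpd S) s t w -> rs_le w v.
  move=> ev [s1 [t1 [s1s t1t /rs_compP[_ ew]]]].
  by have [v'] := rs_mul_mono s1s t1t ew; rewrite ev => -[<-].
have sg := rs_semigroupoid (rs_axioms S).
split=> [eu|[bu maxu]].
  by split=> [|w]; [exact: rs_mul_factor|exact: maxP].
have [s1 [t1 [s1s t1t /rs_compP[_ eu]]]] := bu.
have [v ev _] := rs_mul_mono s1s t1t eu.
rewrite ev; congr Some; apply: rs_le_anti (maxP _ _ ev bu).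
exact/maxu/rs_mul_factor.
Qed.

Lemma rsgpd_of_licatK (S : rsgpd) : rsgpd_of_licat (licat_of_rsgpd S) = S.
Proof.
apply: rsgpd_eq; apply/funext => s; apply/funext => t.
by apply: eq_option => u; rewrite is_prod_rsgpd -li_mulP.
Qed.

Lemma licat_of_rsgpdK (C : licat) : licat_of_rsgpd (rsgpd_of_licat C) = C.
Proof.
have CC := li_category (li_axioms C).
apply: licat_eq.
- apply/funext => x; apply/propext; rewrite /rs_proj /=; split.
    exact: (cat_Rid CC).
  by move=> <-; exact: (cat_R0 CC).
- apply/funext => x; apply/funext => y; apply: eq_option => z.
  apply: iff_trans (iff_sym (@rs_compP (rsgpd_of_licat C) x y z)) => /=.
  split=> [ez|[/li_comp_defP[v ev] /li_mulP]].
    by split; [exact: li_comp_eq ez|exact/li_mulP/is_prod_comp].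
  by rewrite ev => /(is_prod_uniq (is_prod_comp ev)) ->.
- apply/funext => x; apply/funext => y; apply/propext.
  exact: iff_sym (li_leP x y).
Qed.

(** * The isomorphism of categories *)

Definition hom_cast (A : Category) (x x' y y' : A) (p : x = x') (q : y = y')
    (f : Hom x y) : Hom x' y' :=
  match p in _ = a, q in _ = b return Hom a b with erefl, erefl => f end.

Definition cast (X Y : Type) (p : X = Y) (a : X) : Y :=
  match p in _ = Z return Z with erefl => a end.

Lemma cast_id (X : Type) (p : X = X) (a : X) : cast p a = a.
Proof. by rewrite (Prop_irrelevance p erefl). Qed.

Lemma functor_eq_id (A : Category) (H : Functor A A) (e : forall x, H x = x) :
  (forall x y (f : Hom x y), hom_cast (e x) (e y) (Fhom H f) = f) ->
  H = functor_id A.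
Proof.
case: H e => ob hom hom1 homM /= e hf.
have eob : ob = id by apply/funext.
subst ob; have e1 : e = fun x => erefl by exact: Prop_irrelevance.
subst e; have ehom : hom = fun x y f => f.
  by apply: functional_extensionality_dep => x;
     apply: functional_extensionality_dep => y; apply/funext => f; exact: hf.
subst hom; rewrite /functor_id; congr MkFunctor; exact: Prop_irrelevance.
Qed.

Lemma cast_symK (X Y : Type) (p : X = Y) (b : Y) : cast p (cast (esym p) b) = b.
Proof. by case: Y / p b. Qed.

Lemma hom_castE (A : Category) (U : A -> Type)
    (ap : forall x y : A, Hom x y -> U x -> U y) (x x' y y' : A)
    (p : x = x') (q : y = y') (f : Hom x y) (a : U x) :
  ap x' y' (hom_cast p q f) (cast (f_equal U p) a) =
  cast (f_equal U q) (ap x y f a).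
Proof. by case: x' / p; case: y' / q. Qed.

(** When morphisms are determined by functions between carriers, comparing
    transported morphisms amounts to comparing transported values; equality of
    carriers being proof-irrelevant, the transports of values vanish as soon as
    the carriers coincide. *)
Lemma concrete_functor_eq_id (A : Category) (U : A -> Type)
    (ap : forall x y : A, Hom x y -> U x -> U y) (H : Functor A A)
    (e : forall x, H x = x) :
  (forall x y (f g : Hom x y), ap x y f = ap x y g -> f = g) ->
  (forall x y (f : Hom x y) (a : U (H x)),
    cast (f_equal U (e y)) (ap _ _ (Fhom H f) a) =
    ap x y f (cast (f_equal U (e x)) a)) ->
  H = functor_id A.
Proof.
move=> ap_inj h; apply: (functor_eq_id (e := e)) => x y f.
apply: ap_inj; apply/funext => b.
rewrite -(cast_symK (f_equal U (e x)) b) hom_castE; exact: h.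
Qed.

Definition licat_functor : Functor rSGPD_v liCAT_of :=
  @MkFunctor rSGPD_v liCAT_of licat_of_rsgpd ofun_of_vpm
    (fun S => ofun_eq (phi := ofun_of_vpm (vpm_id S)) (psi := ofun_id _) erefl)
    (fun S T U psi phi =>
       ofun_eq (phi := ofun_of_vpm (vpm_comp psi phi))
               (psi := ofun_comp (ofun_of_vpm psi) (ofun_of_vpm phi)) erefl).

Definition rsgpd_functor : Functor liCAT_of rSGPD_v :=
  @MkFunctor liCAT_of rSGPD_v rsgpd_of_licat vpm_of_ofun
    (fun C => vpm_eq (phi := vpm_of_ofun (ofun_id C)) (psi := vpm_id _) erefl)
    (fun C D E psi phi =>
       vpm_eq (phi := vpm_of_ofun (ofun_comp psi phi))
              (psi := vpm_comp (vpm_of_ofun psi) (vpm_of_ofun phi)) erefl).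

Theorem theorem4p14 : isomorphic_categories rSGPD_v liCAT_of.
Proof.
exists licat_functor, rsgpd_functor; split.
- apply: (@concrete_functor_eq_id rSGPD_v rs_carrier vpm_fun
            (functor_comp rsgpd_functor licat_functor) rsgpd_of_licatK).
    exact: vpm_eq.
  by move=> S T phi s; rewrite !cast_id.
- apply: (@concrete_functor_eq_id liCAT_of li_carrier of_fun
            (functor_comp licat_functor rsgpd_functor) licat_of_rsgpdK).
    exact: ofun_eq.
  by move=> C D phi x; rewrite !cast_id.
Qed.
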